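(* Let $n\ge1$ and consider the matrix algebra $M_n(\mathbb{R})$, with an element $s$ identified with the vector in $\mathbb{R}^{n^2}$ obtained by stacking its columns, and let $\mathcal{T}$ be the $n^2\times n^2$ matrix representing the transpose map $s\mapsto s^T$ in these coordinates. Then $\mathfrak{u}_{M_n(\mathbb{R})}$ is one-dimensional, $\mathcal{T}$ is the unique normalized uncurling metric of $M_n(\mathbb{R})$, and the associated special unital norm is $(\det s)^{1/n}$, i.e. the usual norm $(\det s)^n$ (the determinant of the left regular representation of $s$) raised to the power $1/n^2$.
   Context: For an algebra with underlying vector space $\mathbb{R}^N$ (standard basis, elements $s$ as column vectors, $\mathbf{d}s$ the column of coordinate differentials, ''$\cdot$'' the Euclidean dot product, $\|\mathbf{1}\|^2=\mathbf{1}\cdot\mathbf{1}$; for $M_n(\mathbb{R})$, $\|\mathbf{1}\|^2=n$): an uncurling metric is a real symmetric $N\times N$ matrix $L$ with $d\big((s^{-1})^TL\,\mathbf{d}s\big)=0$ on an open ball centered at $\mathbf{1}$ consisting only of units; the anti-rotor $\mathfrak{u}$ is the vector space of uncurling metrics. A normalized uncurling metric is an uncurling metric $L$ with $s^TLs^{-1}=\|\mathbf{1}\|^2$ near $\mathbf{1}$. The unital norm associated with $L$ is $\ell(s)=\exp\!\big(\frac{1}{\|\mathbf{1}\|^2}\int_{\mathbf{1}}^s[Lt^{-1}]\cdot\mathbf{d}t\big)$ near $\mathbf{1}$; a special unital norm is one associated with a normalized uncurling metric. *)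

(* Defs.v *)
From HB Require Import structures.
From mathcomp Require Import all_boot all_order all_algebra.
From mathcomp Require Import all_classical all_reals all_analysis.
Set Implicit Arguments. Unset Strict Implicit. Unset Printing Implicit Defensive.
Import Order.TTheory GRing.Theory Num.Theory.
Import numFieldNormedType.Exports.
Local Open Scope ring_scope.
Local Open Scope classical_set_scope.

(* General notions for an algebra whose underlying vector space is R^N *)
(* (elements are column vectors 'cV[R]_N in the standard basis).       *)
(* The algebra enters through its inverse map [inv], its unit          *)
(* predicate [isunit] and its identity element [one].                  *)

Section General.
Variables (R : realType) (N : nat).
Variables (inv : 'cV[R]_N -> 'cV[R]_N) (isunit : 'cV[R]_N -> Prop)
          (one : 'cV[R]_N).

Definition dotv (x y : 'cV[R]_N) : R := \sum_i x i 0 * y i 0.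

Definition normsq1 : R := dotv one one.

Definition eball (c : 'cV[R]_N) (r : R) : set 'cV[R]_N :=
  [set x | dotv (x - c) (x - c) < r ^+ 2].

(* coefficient column of the 1-form (s^{-1})^T L ds, i.e. L^T s^{-1} *)
Definition uform (L : 'M[R]_N) (s : 'cV[R]_N) : 'cV[R]_N := L^T *m inv s.

(* d omega = 0 at x for the 1-form omega(s) . ds: omega is differentiable
   at x and its Jacobian is symmetric, i.e. (D omega(x) u) . v = (D omega(x) v) . u *)
Definition closed_at (omega : 'cV[R]_N -> 'cV[R]_N) (x : 'cV[R]_N) : Prop :=
  differentiable omega x /\
  forall u v : 'cV[R]_N, dotv ('d omega x u) v = dotv ('d omega x v) u.

Definition uncurling (L : 'M[R]_N) : Prop :=
  L^T = L /\
  exists r : R, 0 < r /\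
    (forall x, eball one r x -> isunit x) /\
    (forall x, eball one r x -> closed_at (uform L) x).

Definition normalized_uncurling (L : 'M[R]_N) : Prop :=
  uncurling L /\
  exists r : R, 0 < r /\
    forall s, eball one r s -> isunit s /\ dotv s (L *m inv s) = normsq1.

(* unital norm associated with L:
   exp( (1/||1||^2) * int_1^s [L t^{-1}] . dt ), the line integral taken
   along the straight segment t = 1 + tau (s - 1), tau in [0,1]. *)
Definition unital_norm (L : 'M[R]_N) (s : 'cV[R]_N) : R :=
  expR (normsq1^-1 *
    Rintegral (@lebesgue_measure R) `[0%R, 1%R]
      (fun tau : R => dotv (L *m inv (one + tau *: (s - one))) (s - one))).

End General.

Section Matn.
Variables (R : realType) (n : nat).

(* stacking the columns of s = stacking the rows of s^T *)
Definition vecc (s : 'M[R]_n) : 'cV[R]_(n * n) := (mxvec s^T)^T.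
Definition unvecc (x : 'cV[R]_(n * n)) : 'M[R]_n := (vec_mx x^T)^T.

Definition mx_inv (x : 'cV[R]_(n * n)) : 'cV[R]_(n * n) :=
  vecc (invmx (unvecc x)).
Definition mx_isunit (x : 'cV[R]_(n * n)) : Prop := unvecc x \in unitmx.
Definition mx_one : 'cV[R]_(n * n) := vecc 1%:M.

Definition basisv (j : 'I_(n * n)) : 'cV[R]_(n * n) := delta_mx j 0.

Definition transpose_mx : 'M[R]_(n * n) :=
  \matrix_(i, j) vecc (unvecc (basisv j))^T i 0.

Definition lreg (s : 'M[R]_n) : 'M[R]_(n * n) :=
  \matrix_(i, j) vecc (s *m unvecc (basisv j)) i 0.

End Matn.

(* Main.v *)
Require Import Defs.
From HB Require Import structures.
From mathcomp Require Import all_boot all_order all_fingroup all_algebra.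
From mathcomp Require Import all_classical all_reals all_analysis.
From mathcomp Require Import ring lra.
Import Order.TTheory GRing.Theory Num.Theory.
Import numFieldNormedType.Exports.
Local Open Scope ring_scope.
Local Open Scope classical_set_scope.
Set Implicit Arguments. Unset Strict Implicit. Unset Printing Implicit Defensive.

(* Write B(a, b) for the bilinear form of L. Since d(s^-1) = - s^-1 ds s^-1,
   the closedness condition at x reads B(x^-1 u x^-1, v) = B(x^-1 v x^-1, u),
   and substituting x u x, x v x for u, v turns it into the same condition with
   x in place of x^-1. The odd part in t of this identity at x = 1 + t h is
   B(hu + uh, v) = B(hv + vh, u), which forces B to be a multiple of the trace
   form tr(ab), i.e. L to be a multiple of T. Conversely tr(x^-1 u x^-1 v) is
   symmetric in u and v. By Jacobi's formula the integrand
   tr((1 + tH)^-1 H) of the unital norm of T, with H = s - 1, is the derivative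
   of ln det(1 + tH). The same computation in M_(n^2)(R) along lreg(1 + tH),
   together with tr(lreg a) = n tr a, gives ln det(lreg s) = n ln det s near 1. *)

(** * Differential calculus of matrix-valued maps *)

Section Differentiability.
Context {R : realType} {V : normedModType R}.

(** The first-order expansion of [f] carries over to [g], as both agree near [x] and at [x] itself.
    It serves for [invmx], which has a closed formula only on units. *)
Lemma near_eq_differentiable (W : normedModType R) (f g : V -> W) (x : V) :
  (\near x, f x = g x) -> differentiable f x -> differentiable g x.
Proof.
move=> fg df.
suff H : g \o shift x = cst (g x) + 'd f x +o_ 0 id.
  have E : 'd g x = 'd f x :> (V -> W).
    by apply: diff_unique => //; exact: diff_continuous.
  apply/diff_locallyP; rewrite E; split=> //; exact: diff_continuous.
apply/eqaddoP => e e0.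
have /diff_locally/eqaddoP/(_ e e0) := df.
have : \forall h \near 0, f (h + x) = g (h + x).
  by have := fg; rewrite (near_shift 0 x) subr0.
move: (nbhs_singleton fg) => fgx.
apply: filterS2 => h /= E; rewrite -fgx.
by rewrite !fctE /= E.
Qed.

Lemma differentiable_mxP m n (M : V -> 'M[R]_(m, n)) (x : V) :
  differentiable M x <-> forall i j, differentiable (fun y => M y i j) x.
Proof.
split=> [dM i j|dM].
  exact: (differentiable_comp dM (@differentiable_coord R m n (M x) i j)).
have -> : M = \sum_i \sum_j (fun y => M y i j *: delta_mx i j).
  apply/funext => y; rewrite fct_sumE [LHS]matrix_sum_delta.
  by apply: eq_bigr => i _; rewrite fct_sumE.
by do 2! (apply: differentiable_sum => ?); exact: differentiableZl.
Qed.

Lemma differentiable_prod (I : Type) (s : seq I) (P : pred I) (f : I -> V -> R)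
    (x : V) : (forall i, differentiable (f i) x) ->
  differentiable (fun y => \prod_(i <- s | P i) f i y) x.
Proof.
move=> df; elim: s => [|i s IH].
  by rewrite (_ : (fun _ => _) = cst 1) //; apply/funext => y; rewrite big_nil.
rewrite (_ : (fun _ => _) = fun y => if P i then f i y * \prod_(j <- s | P j) f j y
    else \prod_(j <- s | P j) f j y); last by apply/funext => y; rewrite big_cons.
by case: (P i) => //; exact: differentiableM.
Qed.

Lemma differentiable_fsum (W : normedModType R) (I : finType) (P : pred I)
    (f : I -> V -> W) (x : V) : (forall i, differentiable (f i) x) ->
  differentiable (fun y => \sum_(i | P i) f i y) x.
Proof.
move=> df; rewrite (_ : (fun _ => _) = \sum_(i | P i) f i).
  by elim/big_ind : _ => // ? ? g h; apply: differentiableD; [exact: g|exact: h].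
by apply/funext => y; rewrite fct_sumE.
Qed.

Lemma differentiable_det n (M : V -> 'M[R]_n) (x : V) :
  differentiable M x -> differentiable (fun y => \det (M y)) x.
Proof.
move=> /differentiable_mxP dM; apply: differentiable_fsum => s.
by apply: differentiableM => //; exact: differentiable_prod.
Qed.

Lemma differentiable_mulmx m n p (M : V -> 'M[R]_(m, n)) (N : V -> 'M[R]_(n, p))
    (x : V) : differentiable M x -> differentiable N x ->
  differentiable (fun y => M y *m N y) x.
Proof.
move=> /differentiable_mxP dM /differentiable_mxP dN.
apply/differentiable_mxP => i j.
under eq_fun do rewrite mxE.
by apply: differentiable_fsum => k; exact: differentiableM.
Qed.

Lemma near_unitmx n (M : V -> 'M[R]_n) (x : V) : differentiable M x ->
  M x \in unitmx -> \forall y \near x, M y \in unitmx.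
Proof.
move=> /differentiable_det/differentiable_continuous cM.
rewrite unitmxE unitfE => M0.
near=> y; rewrite unitmxE unitfE; near: y.
exact: (cM _ (open_nbhs_nbhs (conj (@open_neq _ 0) M0))).
Unshelve. all: by end_near. Qed.

Lemma differentiable_invmx n (M : V -> 'M[R]_n) (x : V) : differentiable M x ->
  M x \in unitmx -> differentiable (fun y => invmx (M y)) x.
Proof.
(* [invmx] is defined by cases; near a unit it coincides with the adjugate formula, whose entries
   are polynomials divided by a nonvanishing determinant. *)
move=> dM Mx; apply: (@near_eq_differentiable _ (fun y => (\det (M y))^-1 *: \adj (M y))).
  by near=> y; rewrite /invmx ifT //; near: y; exact: near_unitmx.
have dd := differentiable_det dM.
move/differentiable_mxP in dM; apply/differentiable_mxP => i j.
under eq_fun do rewrite !mxE.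
apply: differentiableM.
  by apply: differentiableV => //; rewrite -unitfE -unitmxE.
under eq_fun do rewrite expand_cofactor.
by apply: differentiable_fsum => s; apply: differentiableM => //; exact: differentiable_prod.
Unshelve. all: by end_near. Qed.

Lemma is_derive_coord m n (M : V -> 'M[R]_(m, n)) (x v : V) i j : derivable M x v ->
  is_derive x v (fun y => M y i j) ('D_v M x i j).
Proof.
move=> dM; apply: DeriveDef; first exact: (derivable_mxP _ _ _).1.
by rewrite derive_mx // mxE.
Qed.

Lemma derive_mulmx m n p (M : V -> 'M[R]_(m, n)) (N : V -> 'M[R]_(n, p))
    (x v : V) : derivable M x v -> derivable N x v ->
  'D_v (fun y => M y *m N y) x = 'D_v M x *m N x + M x *m 'D_v N x.
Proof.
move=> dM dN.
have H i j : is_derive x v (fun y => (M y *m N y) i j)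
    (('D_v M x *m N x + M x *m 'D_v N x) i j).
  rewrite (_ : (fun _ => _) = \sum_k ((fun y => M y i k) * (fun y => N y k j))); last first.
    by apply/funext => y; rewrite fct_sumE mxE.
  rewrite !mxE -big_split /=; apply: is_derive_sum => k.
  have dMk := is_derive_coord i k dM; have dNk := is_derive_coord k j dN.
  apply: (is_derive_eq (is_deriveM dMk dNk)).
  by rewrite addrC; congr (_ + _); rewrite /GRing.scale /= mulrC.
rewrite derive_mx; first by apply/matrixP => i j; rewrite mxE derive_val.
by apply/derivable_mxP => i j; exact: ex_derive.
Qed.

Lemma derive_invmx n (M : V -> 'M[R]_n) (x v : V) : differentiable M x ->
  M x \in unitmx ->
  'D_v (fun y => invmx (M y)) x = - (invmx (M x) *m 'D_v M x *m invmx (M x)).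
Proof.
move=> dM Mx; have dI := differentiable_invmx dM Mx.
(* The product equals 1 near [x], where [M y] stays invertible; the product rule then yields the
   derivative of the inverse. *)
have : 'D_v (fun y => M y *m invmx (M y)) x = 0.
  rewrite -(derive_cst (1%:M : 'M[R]_n) x v); apply: near_eq_derive.
  by near=> y; rewrite mulmxV //; near: y; exact: near_unitmx.
rewrite derive_mulmx; try exact: diff_derivable.
move=> /(congr1 (mulmx (invmx (M x)))); rewrite mulmx0 mulmxDr !mulmxA mulVmx //.
by rewrite mul1mx => /eqP; rewrite addrC addr_eq0 => /eqP.
Unshelve. all: by end_near. Qed.

(** Induction on the list with the binary product rule; [uniq] ensures that the condition [i != j]
    drops exactly one factor. *)
Lemma is_derive_prod (I : eqType) (s : seq I) (f : I -> V -> R) (df : I -> R)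
    (x v : V) : uniq s -> (forall i, is_derive x v (f i) (df i)) ->
  is_derive x v (fun y => \prod_(i <- s) f i y)
    (\sum_(i <- s) df i * \prod_(j <- s | i != j) f j x).
Proof.
move=> + dfx; elim: s => [_|i s IH /= /andP[si us]].
  rewrite big_nil (_ : (fun _ => _) = cst 1); first exact: is_derive_cst.
  by apply/funext => y; rewrite big_nil.
rewrite (_ : (fun _ => _) = f i * (fun y => \prod_(j <- s) f j y)); last first.
  by apply/funext => y; rewrite big_cons.
apply: (is_derive_eq (is_deriveM (dfx i) (IH us))).
rewrite addrC big_cons big_cons eqxx /=; congr (_ + _).
  rewrite /GRing.scale /= mulrC; congr (_ * _).
  rewrite [RHS]big_seq_cond [LHS]big_seq; apply: eq_bigl => j.
  by case: (boolP (j \in s)) => //= js; apply/esym; apply: contraNneq si => ->.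
rewrite /GRing.scale /= big_distrr /= big_seq [RHS]big_seq.
apply: eq_bigr => j js; rewrite big_cons ifT; first by rewrite mulrCA.
by apply: contraNneq si => <-.
Qed.

(* Jacobi's formula: the Leibniz expansion of each cofactor collects the terms of
   the product rule applied to the Leibniz expansion of the determinant *)
Lemma is_derive_det n (M : V -> 'M[R]_n) (x v : V) : derivable M x v ->
  is_derive x v (fun y => \det (M y)) (\tr ('D_v M x *m \adj (M x))).
Proof.
move=> dM.
rewrite (_ : (fun _ => _) = \sum_(s : 'S_n) (cst ((-1) ^+ s) *
    (fun y => \prod_i M y i (s i)))); last first.
  by apply/funext => y; rewrite fct_sumE.
have H (s : 'S_n) : is_derive x v (cst ((-1) ^+ s) * (fun y => \prod_i M y i (s i)) : V -> R)
    ((-1) ^+ s * \sum_i 'D_v M x i (s i) * \prod_(j | i != j) M x j (s j)).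
  have P := is_derive_prod (index_enum_uniq 'I_n) (fun i => is_derive_coord i (s i) dM).
  apply: (is_derive_eq (is_deriveM (is_derive_cst _ x v) P)).
  by rewrite scaler0 addr0.
suff -> : \tr ('D_v M x *m \adj (M x)) = \sum_(s : 'S_n)
    (-1) ^+ s * \sum_i 'D_v M x i (s i) * \prod_(j | i != j) M x j (s j).
  by elim/big_ind2: _ => [|f df g dg ? ?|//]; [exact: is_derive_cst|exact: is_deriveD].
under [RHS]eq_bigr do rewrite big_distrr /=.
rewrite exchange_big; apply: eq_bigr => i _; rewrite mxE.
under [LHS]eq_bigr do rewrite mxE expand_cofactor.
rewrite [RHS](partition_big (fun s : 'S_n => s i) predT) //=.
apply: eq_bigr => j _; rewrite big_distrr /=.
by apply: eq_bigr => s /eqP sij; rewrite sij mulrCA.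
Qed.

End Differentiability.

(** * Integrating the logarithmic derivative of a determinant along a segment *)

Section Segment.
Context {R : realType}.

Section LnDet.
Variables (n : nat) (H : 'M[R]_n).
Let M (t : R) : 'M[R]_n := 1%:M + t *: H.
Hypothesis M_gt0 : forall t, 0 <= t <= 1 -> 0 < \det (M t).

Let dM (t : R) : differentiable M t.
Proof. by apply: differentiableD => //; exact: differentiableZl. Qed.

Let DM (t : R) : 'D_1 M t = H.
Proof.
have D : is_diff t M (cst 0 + *:%R^~ H) :=
  is_diffD (is_diff_cst 1%:M t) (is_diff_scalel t H).
by rewrite deriveE // diff_val !fctE add0r scale1r.
Qed.

Let Mu (t : R) : 0 <= t <= 1 -> M t \in unitmx.
Proof. by move=> /M_gt0 Mt; rewrite unitmxE unitfE gt_eqF. Qed.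

Let F (t : R) : R := ln (\det (M t)).
Let f (t : R) : R := \tr (invmx (M t) *m H).

(** Jacobi's formula gives [tr (H adj (M t))] for the determinant; the factor [1 / det (M t)] from
    [ln] turns the adjugate into the inverse. *)
Let derF (t : R) : 0 <= t <= 1 -> is_derive t 1 F (f t).
Proof.
move=> t01; have dMt : derivable M t 1 by exact: diff_derivable.
have := is_derive_det dMt.
move=> /(is_derive1_comp (is_derive1_ln (M_gt0 t01))) D; apply: (is_derive_eq D).
by rewrite DM /f [RHS]mxtrace_mulC /invmx Mu // -scalemxAr linearZ.
Qed.

Let contf (t : R) : 0 <= t <= 1 -> {for t, continuous f}.
Proof.
move=> t01; apply: (@differentiable_continuous R R R).
apply: differentiable_fsum => i.
have dI := differentiable_invmx (dM t) (Mu t01).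
have /differentiable_mxP := differentiable_mulmx dI (differentiable_cst H t).
exact.
Qed.

(** Needed to move the constant [n] across the integral when [lreg] is compared with the identity
    representation. *)
Lemma integrable_trace_segment :
  (@lebesgue_measure R).-integrable `[0%R, 1%R] (EFin \o f).
Proof.
apply: continuous_compact_integrable; first exact: segment_compact.
by apply: continuous_in_subspaceT => t /set_mem /=; rewrite in_itv => /contf.
Qed.

Lemma Rintegral_trace_segment :
  Rintegral (@lebesgue_measure R) `[0%R, 1%R] f = ln (\det (1%:M + H)).
Proof.
rewrite /Rintegral (@continuous_FTC2 _ f F) //.
(* The lower boundary term vanishes: [F 0 = ln (det 1) = 0]. *)
- rewrite /F /M scale1r scale0r addr0 det1 ln1 oppe0 adde0 //.
- by apply: continuous_in_subspaceT => t /set_mem /=; rewrite in_itv => /contf.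
- have cF t : 0 <= t <= 1 -> {for t, continuous F}.
    move=> /derF dF; apply: (@differentiable_continuous R R R).
    by apply/derivable1_diffP; exact: ex_derive.
  split.
  + move=> t; rewrite in_itv /= => /andP[t0 t1].
    by have := @derF t; rewrite !ltW // => /(_ isT) ?; exact: ex_derive.
  + by apply: cvg_at_right_filter; apply: cF; rewrite lexx ler01.
  + by apply: cvg_at_left_filter; apply: cF; rewrite lexx ler01.
- move=> t; rewrite in_itv /= => /andP[t0 t1].
  rewrite derive1E; have := @derF t; rewrite !ltW // => /(_ isT) ?.
  exact: derive_val.
Qed.

End LnDet.

(** * Euclidean balls *)

Section EuclideanBall.
Variable N : nat.
Implicit Types c x : 'cV[R]_N.

(** The ambient topology comes from the max norm, which the Euclidean norm dominates, so the
    Euclidean ball of radius [e] lies in the max-norm ball of the same radius. *)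
Lemma nbhs_eball c (A : set 'cV[R]_N) : nbhs c A ->
  exists r, 0 < r /\ eball c r `<=` A.
Proof.
move=> /nbhs_ballP[e /= e0 eA]; exists e; split=> // x; rewrite /eball /= => xe.
apply: eA; rewrite -ball_normE /= distrC.
rewrite [ltLHS]/Num.Def.normr /= mx_normrE; apply: bigmax_lt => //= -[i j] _.
rewrite (ord1 j) /= -ltr_sqr ?nnegrE //; last exact: ltW.
rewrite real_normK ?num_real //; apply: le_lt_trans xe.
rewrite /dotv (bigD1 i) //= -expr2 lerDl sumr_ge0 // => k _.
by rewrite -expr2 sqr_ge0.
Qed.

Lemma dotvZ2 x (t : R) : dotv (t *: x) (t *: x) = t ^+ 2 * dotv x x.
Proof.
rewrite /dotv big_distrr /=; apply: eq_bigr => i _.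
by rewrite !mxE expr2 mulrACA.
Qed.

(** Scaling by [t] shrinks the distance to the centre. Hence the integration path of [unital_norm]
    stays where the determinants are positive. *)
Lemma eball_segment c (r : R) x (t : R) : 0 <= t <= 1 -> eball c r x ->
  eball c r (c + t *: (x - c)).
Proof.
move=> /andP[t0 t1]; rewrite /eball /= [c + _]addrC addrK dotvZ2.
apply: le_lt_trans; rewrite ler_piMl ?exprn_ile1 //.
by apply: sumr_ge0 => i _; rewrite -expr2 sqr_ge0.
Qed.

Lemma eball_center c (r : R) : 0 < r -> eball c r c.
Proof.
move=> r0; rewrite /eball /= subrr /dotv big1 ?exprn_gt0 // => i _.
by rewrite mxE mul0r.
Qed.

End EuclideanBall.
End Segment.

(** * Column stacking, the transpose matrix and the left regular representation *)

Section Vectorization.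
Context {R : realType} {n : nat}.
Implicit Types (a b s : 'M[R]_n) (x y : 'cV[R]_(n * n)).

(** [mxvec] lists rows and is applied to the transpose, so the column index comes first. *)
Lemma veccE a i j : vecc a (mxvec_index j i) 0 = a i j.
Proof. by rewrite /vecc mxE mxvecE mxE. Qed.

Lemma veccK : cancel (@vecc R n) (@unvecc R n).
Proof. by move=> a; rewrite /unvecc /vecc trmxK mxvecK trmxK. Qed.

Lemma unveccK : cancel (@unvecc R n) (@vecc R n).
Proof. by move=> x; rewrite /unvecc /vecc trmxK vec_mxK trmxK. Qed.

Lemma vecc_is_linear : linear (@vecc R n).
Proof. by move=> c a b; rewrite /vecc !linearP. Qed.
HB.instance Definition _ := GRing.isLinear.Build R 'M[R]_n 'cV[R]_(n * n) _
  (@vecc R n) vecc_is_linear.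

Lemma unvecc_is_linear : linear (@unvecc R n).
Proof. by move=> c a b; rewrite /unvecc !linearP. Qed.
HB.instance Definition _ := GRing.isLinear.Build R 'cV[R]_(n * n) 'M[R]_n _
  (@unvecc R n) unvecc_is_linear.

Lemma big_vecc (S : nmodType) (F : 'I_(n * n) -> S) :
  \sum_k F k = \sum_j \sum_i F (mxvec_index i j).
Proof.
rewrite (reindex _ (curry_mxvec_bij n n)) /= exchange_big pair_bigA /=.
by apply: eq_bigr => -[].
Qed.

Lemma dotv_vecc a b : dotv (vecc a) (vecc b) = \tr (a^T *m b).
Proof.
rewrite /dotv big_vecc exchange_big; apply: eq_bigr => j _; rewrite mxE.
by apply: eq_bigr => i _; rewrite !veccE mxE.
Qed.

(** Both [transpose_mx] and [lreg] are given by the images of basis vectors; this recovers their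
    action on an arbitrary vector. *)
Lemma matrix_of_linear_mul N (f : {linear 'cV[R]_N -> 'cV[R]_N}) (x : 'cV[R]_N) :
  (\matrix_(i, j) f (delta_mx j 0) i 0) *m x = f x.
Proof.
apply/colP => i; rewrite [in RHS](matrix_sum_delta x) linear_sum summxE mxE.
apply: eq_bigr => j _; rewrite big_ord1 linearZ /= !mxE mulrC.
by congr (_ * f _ _ _); rewrite (ord1 0).
Qed.

Lemma transpose_mx_vecc a : transpose_mx R n *m vecc a = vecc a^T.
Proof.
have := matrix_of_linear_mul (@vecc R n \o trmx \o @unvecc R n) (vecc a).
by rewrite /= veccK.
Qed.

Lemma lreg_vecc s a : lreg s *m vecc a = vecc (s *m a).
Proof.
have := matrix_of_linear_mul (@vecc R n \o mulmx s \o @unvecc R n) (vecc a).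
by rewrite /= veccK.
Qed.

Lemma eq_mulmx_vecc (A B : 'M[R]_(n * n)) :
  (forall a, A *m vecc a = B *m vecc a) -> A = B.
Proof.
move=> AB; apply/matrixP => i j.
have := congr1 (fun x : 'cV[R]_(n * n) => x i 0) (AB (unvecc (delta_mx j 0))).
by rewrite unveccK -!colE !mxE.
Qed.

Lemma lreg_1mx : lreg 1%:M = 1%:M :> 'M[R]_(n * n).
Proof. by apply: eq_mulmx_vecc => a; rewrite lreg_vecc !mul1mx. Qed.

Lemma lreg_is_linear : linear (@lreg R n).
Proof.
move=> c a b; apply: eq_mulmx_vecc => s.
by rewrite mulmxDl -scalemxAl !lreg_vecc mulmxDl -scalemxAl linearP.
Qed.
HB.instance Definition _ := GRing.isLinear.Build R 'M[R]_n 'M[R]_(n * n) _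
  (@lreg R n) lreg_is_linear.

Lemma lreg_mulmx a b : lreg (a *m b) = lreg a *m lreg b.
Proof. by apply: eq_mulmx_vecc => c; rewrite -mulmxA !lreg_vecc mulmxA. Qed.

Lemma lreg_invmx a : a \in unitmx -> lreg (invmx a) = invmx (lreg a).
Proof.
move=> ua; have e : lreg (invmx a) *m lreg a = 1%:M by rewrite -lreg_mulmx mulVmx // lreg_1mx.
have [_ ula] := mulmx1_unit e.
by rewrite -[LHS]mulmx1 -(mulmxV ula) mulmxA e mul1mx.
Qed.

(** Left multiplication acts on each column separately, so [lreg s] is block diagonal with [n]
    copies of [s]. *)
Lemma lregE s i j k l : lreg s (mxvec_index j i) (mxvec_index l k) =
  s i k *+ (j == l).
Proof.
transitivity ((lreg s *m vecc (delta_mx k l)) (mxvec_index j i) 0).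
  have -> : vecc (delta_mx k l) = delta_mx (mxvec_index l k) 0 :> 'cV[R]_(n * n).
    by rewrite /vecc trmx_delta mxvec_delta trmx_delta.
  by rewrite -colE [RHS]mxE.
rewrite lreg_vecc veccE mxE (bigD1 k) //= big1 => [|m mk].
  by rewrite !mxE eqxx addr0 mulr_natr.
by rewrite mxE (negbTE mk) mulr0.
Qed.

Lemma mxtrace_lreg s : \tr (lreg s) = n%:R * \tr s.
Proof.
transitivity (\sum_(j < n) \tr s); last by rewrite sumr_const card_ord mulr_natl.
rewrite {1}/mxtrace big_vecc exchange_big.
by apply: eq_bigr => j _; apply: eq_bigr => i _; rewrite lregE eqxx.
Qed.

End Vectorization.

(** * Characterization of the multiples of the trace form *)

Section TraceForm.
Context {R : realType} {n : nat}.
Implicit Types (a b h u v : 'M[R]_n).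

(* For i != j, E_ij = [E_ii, [E_ii, E_ij]] and E_jj - E_ii = [E_ij, [E_ii, E_ji]]. *)
Lemma scalar_commutator2_trace (f : {scalar 'M[R]_n}) (i0 : 'I_n) :
  (forall h u v, f (h *m (u *m v - v *m u)) = f ((u *m v - v *m u) *m h)) ->
  forall a, f a = f (delta_mx i0 i0) * \tr a.
Proof.
move=> fC a.
have f0 i j : i != j -> f (delta_mx i j) = 0.
  move=> ij; have ji : (j == i) = false by rewrite eq_sym (negbTE ij).
  have := fC (delta_mx i i) (delta_mx i i) (delta_mx i j).
  rewrite mul_delta_mx mul_delta_mx_0 ?ji // subr0 mul_delta_mx mul_delta_mx_0 ?ji //.
  by rewrite linear0.
have fd i : f (delta_mx i i) = f (delta_mx i0 i0).
  have [->//|ij] := eqVneq i i0.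
  have ji : (i0 == i) = false by rewrite eq_sym (negbTE ij).
  have := fC (delta_mx i i0) (delta_mx i i) (delta_mx i0 i).
  rewrite mul_delta_mx_0 // mul_delta_mx sub0r mulmxN mulNmx !mul_delta_mx.
  by rewrite !linearN => /oppr_inj.
rewrite [in LHS](matrix_sum_delta a) linear_sum /= mulr_sumr.
apply: eq_bigr => i _; rewrite linear_sum (bigD1 i) //= big1 => [|j ji].
  by rewrite linearZ /= addr0 fd mulrC.
by rewrite linearZ /= f0 1?eq_sym // mulr0.
Qed.

(* Taking v = 1 expresses the form through the linear form [f := B^~ 1], since
   2 B h u = f (h u + u h); the general identity then says that f kills
   every double commutator. *)
Lemma jordan_form_trace (B : 'M[R]_n -> 'M[R]_n -> R) (hn : (0 < n)%N) :
  (forall v, scalar (B^~ v)) ->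
  (forall h u v, B (h *m u + u *m h) v = B (h *m v + v *m h) u) ->
  exists c, forall a b, B a b = c * \tr (a *m b).
Proof.
move=> Blin BJ.
have [f Bf] : exists f : {scalar 'M[R]_n},
    forall h u, 2 * B h u = f (h *m u) + f (u *m h).
  pose fM := GRing.isLinear.Build _ _ _ _ (B^~ 1%:M) (Blin 1%:M).
  pose f : {scalar 'M[R]_n} := HB.pack (B^~ 1%:M) fM.
  exists f => h u; rewrite -linearD /= BJ mulmx1 mul1mx.
  have := Blin u 1 h h; rewrite /= !scale1r mul1r => ->.
  by rewrite mulr_natl mulr2n.
pose i0 := Ordinal hn.
have fC h u v : f (h *m (u *m v - v *m u)) = f ((u *m v - v *m u) *m h).
  (* In the expansion [f (u h v)] and [f (v h u)] occur on both sides and cancel; what remains is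
     the claim. The six triple products are then abstracted as atoms for [lra]. *)
  have := congr1 ( *%R 2) (BJ h u v); rewrite !Bf.
  rewrite !(mulmxDl, mulmxDr, mulmxN, mulNmx) !(linearD f) !(linearN f) !mulmxA.
  by do 6 move: (f _); clear => *; lra.
have ft := scalar_commutator2_trace i0 fC.
exists (f (delta_mx i0 i0)) => a b.
apply: (mulfI (_ : 2 != 0 :> R)); first by rewrite pnatr_eq0.
by rewrite Bf (ft (a *m b)) (ft (b *m a)) [\tr (b *m a)]mxtrace_mulC mulr_natl mulr2n.
Qed.

End TraceForm.

(** * The Euclidean dot product *)

Section Dotv.
Context {R : realType} {N : nat}.
Implicit Types (x y z : 'cV[R]_N) (A : 'M[R]_N).

Lemma dotvE x y : dotv x y = (x^T *m y) 0 0.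
Proof. by rewrite mxE; apply: eq_bigr => i _; rewrite mxE. Qed.

Lemma dotvC x y : dotv x y = dotv y x.
Proof. by apply: eq_bigr => i _; rewrite mulrC. Qed.

Lemma dotv_linearl (c : R) x y z : dotv (c *: x + y) z = c * dotv x z + dotv y z.
Proof. by rewrite !dotvE linearP mulmxDl -scalemxAl !mxE. Qed.

Lemma dotvZl (c : R) x z : dotv (c *: x) z = c * dotv x z.
Proof. by rewrite !dotvE linearZ -scalemxAl mxE. Qed.

Lemma dotvNl x z : dotv (- x) z = - dotv x z.
Proof. by rewrite !dotvE linearN mulNmx mxE. Qed.

Lemma dotv_trmx A x y : dotv (A^T *m x) y = dotv x (A *m y).
Proof. by rewrite !dotvE trmx_mul trmxK mulmxA. Qed.

Lemma dotv_inj x y : (forall z, dotv x z = dotv y z) -> x = y.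
Proof.
move=> xy; apply/colP => i; have := xy (delta_mx i 0).
by rewrite !dotvE -!colE !mxE.
Qed.

End Dotv.

(** * Differentials of linear maps on matrices *)

Section LinearMx.
Context {R : realType} {m n : nat} {W : normedModType R}.

(** By finite dimension: over the basis [delta_mx i j] the map is a finite sum of coordinates times
    fixed vectors. *)
Lemma mx_linear_continuous (f : {linear 'M[R]_(m, n) -> W}) : continuous f.
Proof.
move=> M; apply: differentiable_continuous.
rewrite (_ : (f : _ -> _) = fun A => \sum_i \sum_j A i j *: f (delta_mx i j)).
  apply: differentiable_fsum => i; apply: differentiable_fsum => j.
  by apply: differentiableZl; exact: differentiable_coord.
apply/funext => A; rewrite [in LHS](matrix_sum_delta A) linear_sum.
by apply: eq_bigr => i _; rewrite linear_sum; apply: eq_bigr => j _; rewrite linearZ.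
Qed.

Lemma is_diff_mx_linear (f : {linear 'M[R]_(m, n) -> W}) x : is_diff x f f.
Proof.
have cf : continuous f by exact: mx_linear_continuous.
by apply: DiffDef; [exact: linear_differentiable|exact: diff_lin].
Qed.

End LinearMx.

(** * Uncurling metrics and the unital norm of the matrix algebra *)

Section MatrixAlgebra.
Context {R : realType} {n : nat}.
Implicit Types (a b s u v h : 'M[R]_n) (x y : 'cV[R]_(n * n)) (L : 'M[R]_(n * n)).
Local Notation one := (mx_one R n).
Local Notation T := (transpose_mx R n).
Local Notation uncurlingMn := (uncurling (@mx_inv R n) (@mx_isunit R n) one).

Lemma is_diff_uform L x : unvecc x \in unitmx ->
  is_diff x (uform (@mx_inv R n) L) (fun w => - (L^T *m
    vecc (invmx (unvecc x) *m unvecc w *m invmx (unvecc x)))).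
Proof.
move=> ux; pose G : {linear 'M[R]_n -> 'cV[R]_(n * n)} := mulmx L^T \o @vecc R n.
have dU : is_diff x (@unvecc R n) (@unvecc R n) := is_diff_mx_linear _ x.
have dG a : is_diff a G G := is_diff_mx_linear _ a.
have dI := differentiable_invmx (@ex_diff _ _ _ _ _ _ _ dU) ux.
rewrite (_ : uform _ _ = G \o (fun y => invmx (unvecc y))) //.
apply: DiffDef; first exact: differentiable_comp.
rewrite diff_comp //; apply/funext => u /=.
rewrite (@diff_val _ _ _ _ _ _ _ (dG _)) -deriveE // derive_invmx // deriveE //.
by rewrite diff_val linearN.
Qed.

(** For a unit [x] the map sending [w] to [x w x] is bijective; using it one way and its inverse the
    other way gives the two implications. *)
Lemma closed_at_uform L x : unvecc x \in unitmx ->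
  closed_at (uform (@mx_inv R n) L) x <->
  forall u v, dotv (L^T *m vecc u) (vecc (unvecc x *m v *m unvecc x)) =
              dotv (L^T *m vecc v) (vecc (unvecc x *m u *m unvecc x)).
Proof.
move=> ux; have dL := is_diff_uform L ux.
rewrite /closed_at diff_val; split=> [[_ E] u v|E].
  have := E (vecc (unvecc x *m u *m unvecc x)) (vecc (unvecc x *m v *m unvecc x)).
  by rewrite !veccK -!mulmxA !mulmxV // !mulmx1 !mulKmx // !dotvNl => /oppr_inj.
split=> // u v; rewrite !dotvNl; congr (- _).
have := E (invmx (unvecc x) *m unvecc u *m invmx (unvecc x))
  (invmx (unvecc x) *m unvecc v *m invmx (unvecc x)).
by rewrite -!mulmxA !mulVmx // !mulmx1 !mulKVmx // !unveccK.
Qed.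

Lemma dotv_transpose_mx a b : dotv (T *m vecc a) (vecc b) = \tr (a *m b).
Proof. by rewrite transpose_mx_vecc dotv_vecc trmxK. Qed.

(** [T] represents the form [tr (a b)], whose symmetry is cyclicity of the trace. *)
Lemma trmx_transpose_mx : T^T = T.
Proof.
apply: eq_mulmx_vecc => a; apply: dotv_inj => y; rewrite -(unveccK y).
by rewrite dotv_trmx dotvC !dotv_transpose_mx mxtrace_mulC.
Qed.

(** A single ball for all local claims about [T]: its points are units, and both logarithms of
    determinants have positive arguments there. *)
Lemma near_one_det_gt0 : exists r, 0 < r /\
  eball one r `<=` [set x | 0 < \det (unvecc x) /\ 0 < \det (lreg (unvecc x))].
Proof.
apply: nbhs_eball.
have pos m (f : 'cV[R]_(n * n) -> 'M[R]_m) : differentiable f one ->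
    f one = 1%:M -> \forall x \near one, 0 < \det (f x).
  move=> /differentiable_det/differentiable_continuous cf f1.
  by apply: (cvgr_gt _ cf); rewrite f1 det1.
have dU : is_diff one (@unvecc R n) (@unvecc R n) := is_diff_mx_linear _ one.
have dl : is_diff one (@lreg R n \o @unvecc R n) (@lreg R n \o @unvecc R n).
  exact: (is_diff_mx_linear (@lreg R n \o @unvecc R n) one).
apply: filterI; first by apply: (pos n (@unvecc R n)) => //; exact: veccK.
apply: (pos _ (@lreg R n \o @unvecc R n)); first exact: ex_diff.
by rewrite /= (veccK 1%:M) lreg_1mx.
Qed.

Lemma det_gt0_unitmx a : 0 < \det a -> a \in unitmx.
Proof. by move=> a0; rewrite unitmxE unitfE gt_eqF. Qed.

(** At a unit [x] closedness reads [tr (u x v x) = tr (v x u x)], again cyclicity. *)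
Lemma uncurling_transpose_mx (c : R) : uncurlingMn (c *: T).
Proof.
split; first by rewrite linearZ /= trmx_transpose_mx.
have [r [r0 rP]] := near_one_det_gt0.
have ru x : eball one r x -> mx_isunit x by move=> /rP[/det_gt0_unitmx].
exists r; split=> //; split=> // x /ru ux; rewrite closed_at_uform // => u v.
rewrite linearZ /= trmx_transpose_mx -!scalemxAl !dotvZl !dotv_transpose_mx.
by rewrite !mulmxA mxtrace_mulC !mulmxA mxtrace_mulC !mulmxA.
Qed.

Lemma normsq1_mx_one : normsq1 one = n%:R :> R.
Proof. by rewrite /normsq1 dotv_vecc trmx1 mul1mx mxtrace1. Qed.

(** With [c = 1] this gives the normalization of [T]; for general [c] it lets the normalization
    determine [c]. *)
Lemma dotv_inv_scaled_transpose_mx (c : R) x : mx_isunit x ->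
  dotv x ((c *: T) *m mx_inv x) = c * n%:R.
Proof.
move=> ux; rewrite dotvC -scalemxAl dotvZl -[X in dotv _ X](unveccK x).
by rewrite dotv_transpose_mx mulVmx // mxtrace1.
Qed.

Lemma normalized_transpose_mx : normalized_uncurling (@mx_inv R n) (@mx_isunit R n) one T.
Proof.
rewrite -[T]scale1r; split; first exact: uncurling_transpose_mx.
have [r [r0 rP]] := near_one_det_gt0; exists r; split=> // s /rP[/det_gt0_unitmx us _].
by split=> //; rewrite dotv_inv_scaled_transpose_mx // mul1r normsq1_mx_one.
Qed.

Lemma uncurling_scaled_transpose_mx L (hn : (0 < n)%N) : uncurlingMn L ->
  exists c, L = c *: T.
Proof.
move=> [Lsym [r [r0 [ru rc]]]].
pose B a b := dotv (L *m vecc a) (vecc b).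
have Blin v : scalar (B^~ v).
  by move=> c a b; rewrite /B linearP mulmxDr -scalemxAr dotv_linearl.
have Bsym a b : B a b = B b a by rewrite /B -{1}Lsym dotv_trmx dotvC.
(* Symmetry of [L] removes the transpose in [uform] and moves the factor [x _ x] to the first
   argument. *)
have BC (x : 'M[R]_n) u v : eball one r (vecc x) -> B (x *m u *m x) v = B (x *m v *m x) u.
  move=> xr; have := rc _ xr; rewrite closed_at_uform; last exact: ru.
  by rewrite veccK Lsym => /(_ v u); rewrite -/(B _ _) Bsym => ->; rewrite Bsym.
(* The sign [e] is 1 or -1: both points [1 + t h] and [1 - t h] must lie in the ball. *)
have near1 h : exists2 t, 0 < t & forall e, e ^+ 2 = 1 ->
    eball one r (vecc (1%:M + (e * t) *: h)).
  set q := dotv (vecc h) (vecc h).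
  have q0 : 0 <= q by apply: sumr_ge0 => i _; rewrite -expr2 sqr_ge0.
  have q1 : 0 < 1 + q by lra.
  (* The squared distance to 1 is [r^2 q / (1 + q)^2], less than [r^2] because [q < (1 + q)^2]. *)
  exists (r / (1 + q)); first by rewrite divr_gt0.
  move=> e e1; rewrite /eball /= linearD linearZ /= -/(mx_one R n).
  rewrite [one + _]addrC addrK dotvZ2 -/q exprMn e1 mul1r expr_div_n.
  rewrite mulrAC ltr_pdivrMr ?exprn_gt0 // ltr_pM2l ?exprn_gt0 //.
  nra.
have BJ h u v : B (h *m u + u *m h) v = B (h *m v + v *m h) u.
  have [t t0 ht] := near1 h.
  have expand e (x y : 'M[R]_n) : B ((1%:M + (e * t) *: h) *m x *m (1%:M + (e * t) *: h)) y =
      B x y + e * t * B (h *m x + x *m h) y + (e * t) ^+ 2 * B (h *m x *m h) y.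
    have -> : (1%:M + (e * t) *: h) *m x *m (1%:M + (e * t) *: h) =
        (e * t) ^+ 2 *: (h *m x *m h) + ((e * t) *: (h *m x + x *m h) + x).
      rewrite !(mulmxDl, mulmxDr, mul1mx, mulmx1) -!scalemxAl -!scalemxAr scalerA -expr2 scalerDr.
      by rewrite addrA [RHS]addrC; congr (_ + _); rewrite -addrA addrC.
    by rewrite !Blin; ring.
  (* Subtracting the instances at [e = 1] and [e = -1] cancels the even powers of [t]; the odd part
     is then divided by [2 t > 0]. *)
  have := BC _ u v (ht 1 (expr1n _ _)).
  have := BC _ u v (ht (-1) (etrans (sqrrN 1) (expr1n _ _))).
  rewrite !expand; nra.
have [c Bc] := jordan_form_trace hn Blin BJ.
exists c; apply: eq_mulmx_vecc => a; apply: dotv_inj => y; rewrite -(unveccK y).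
by rewrite -/(B _ _) Bc -scalemxAl dotvZl dotv_transpose_mx.
Qed.

Lemma transpose_mx_neq0 (hn : (0 < n)%N) : T != 0.
Proof.
apply/eqP => T0; have := dotv_transpose_mx 1%:M 1%:M.
rewrite T0 mul0mx dotvE trmx0 mul0mx mxE mulmx1 mxtrace1 => /esym/eqP.
by rewrite pnatr_eq0 -leqn0 leqNgt hn.
Qed.

Lemma normalized_uncurling_unique L (hn : (0 < n)%N) :
  normalized_uncurling (@mx_inv R n) (@mx_isunit R n) one L -> L = T.
Proof.
move=> [/(uncurling_scaled_transpose_mx hn)[c ->] [r [r0 /(_ one)]]].
(* Evaluated at the identity, the normalization becomes [c n = n]. *)
move=> /(_ (eball_center _ r0))[u1]; rewrite dotv_inv_scaled_transpose_mx //.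
rewrite normsq1_mx_one -[RHS]mul1r => /mulIf ->; rewrite ?scale1r //.
by rewrite pnatr_eq0 -lt0n.
Qed.

Lemma unital_norm_transpose_mx (hn : (0 < n)%N) : exists r, 0 < r /\
  forall s, eball one r (vecc s) ->
    [/\ 0 < \det s, 0 < \det (lreg s),
      unital_norm (@mx_inv R n) one T (vecc s) = expR (n%:R^-1 * ln (\det s)) &
      ln (\det (lreg s)) = n%:R * ln (\det s)].
Proof.
have [r [r0 rP]] := near_one_det_gt0; exists r; split=> // s sr.
pose H := s - 1%:M; have sE : s = 1%:M + H by rewrite addrC subrK.
have seg t : one + t *: (vecc s - one) = vecc (1%:M + t *: H).
  have -> : vecc s - one = vecc H by rewrite linearB.
  by rewrite [RHS]linearD [in RHS]linearZ.
have segr t : 0 <= t <= 1 -> eball one r (vecc (1%:M + t *: H)).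
  by move=> t01; rewrite -seg; exact: eball_segment.
have det0 t : 0 <= t <= 1 -> 0 < \det (1%:M + t *: H).
  by move=> /segr/rP /=; rewrite veccK => -[].
have lregH t : lreg (1%:M + t *: H) = 1%:M + t *: lreg H.
  by rewrite linearD linearZ /= lreg_1mx.
have detl0 t : 0 <= t <= 1 -> 0 < \det (1%:M + t *: lreg H).
  by move=> /segr/rP /=; rewrite veccK lregH => -[].
have [d0 dl0] := rP _ sr; rewrite /= veccK in d0 dl0.
split=> //.
  rewrite /unital_norm normsq1_mx_one; congr (expR (_ * _)).
  rewrite [in RHS]sE -(Rintegral_trace_segment det0); apply: eq_Rintegral => t _.
  by rewrite seg /mx_inv veccK -[one]/(vecc 1%:M) -linearB dotv_transpose_mx.
have := Rintegral_trace_segment detl0.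
rewrite -[1%:M in X in _ = X]lreg_1mx -linearD -sE => <-.
rewrite [in RHS]sE -(Rintegral_trace_segment det0) -RintegralZl //; last first.
  exact: integrable_trace_segment.
(* The integrands agree pointwise, since [lreg] commutes with inversion and multiplies the trace by
   [n]. *)
apply: eq_Rintegral => t /set_mem /=; rewrite in_itv /= => t01.
by rewrite -lregH -lreg_invmx ?det_gt0_unitmx ?det0 // -lreg_mulmx mxtrace_lreg.
Qed.

End MatrixAlgebra.

Theorem theorem8p1 (R : realType) (n : nat) (hn : (0 < n)%N) :
  (* the anti-rotor u_{M_n(R)} is one-dimensional *)
  (exists L0 : 'M[R]_(n * n), L0 != 0 /\
     forall L : 'M[R]_(n * n),
       uncurling (@mx_inv R n) (@mx_isunit R n) (mx_one R n) L <->
       exists c : R, L = c *: L0) /\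
  (* T is the unique normalized uncurling metric *)
  normalized_uncurling (@mx_inv R n) (@mx_isunit R n) (mx_one R n)
    (transpose_mx R n) /\
  (forall L : 'M[R]_(n * n),
     normalized_uncurling (@mx_inv R n) (@mx_isunit R n) (mx_one R n) L ->
     L = transpose_mx R n) /\
  (* the associated special unital norm is (det s)^(1/n)
     = (det of the left regular representation of s)^(1/n^2), near 1 *)
  (exists r : R, 0 < r /\
     forall s : 'M[R]_n, eball (mx_one R n) r (vecc s) ->
       unital_norm (@mx_inv R n) (mx_one R n) (transpose_mx R n) (vecc s)
         = powR (\det s) (n%:R^-1) /\
       unital_norm (@mx_inv R n) (mx_one R n) (transpose_mx R n) (vecc s)
         = powR (\det (lreg s)) ((n ^ 2)%:R^-1)).
Proof.
split; [|split; [|split]].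
- exists (transpose_mx R n); split; first exact: transpose_mx_neq0.
  move=> L; split; first exact: uncurling_scaled_transpose_mx.
  by move=> [c ->]; exact: uncurling_transpose_mx.
- exact: normalized_transpose_mx.
- by move=> L; exact: normalized_uncurling_unique.
- have [r [r0 rP]] := @unital_norm_transpose_mx R n hn; exists r; split=> // s /rP.
  (* [powR] is defined by cases on a zero base; positivity selects the branch [expR (a * ln x)], and
     the second exponent reduces by [n^-2 n = n^-1]. *)
  move=> [d0 dl0 -> lE]; rewrite /powR !gt_eqF // lE; split=> //.
  rewrite natrX mulrA expr2 invfM mulrVK //.
  by rewrite unitfE pnatr_eq0 -lt0n.
Qed.
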